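(* Let $X$ be a dyadic compactum with a base $\mathcal{A}$ consisting only of cozero sets. If $Nt(X)\leq\omega_1$, then $\mathcal{A}$ contains a subset that is an $\omega^{\mathrm{op}}$-like base of $X$. Hence, no dyadic compactum has Noetherian type $\omega_1$.
   Context: A dyadic compactum is a Hausdorff continuous image of $2^\kappa$ for some cardinal $\kappa$. A cozero set is a set of the form $X\setminus f^{-1}\{0\}$ for continuous $f\colon X\to\mathbb{R}$. Families of open sets are ordered by inclusion; a family is $\mu^{\mathrm{op}}$-like if no member is contained in $\mu$-many members. $Nt(X)$ (Noetherian type) is the least $\mu\geq\omega$ such that $X$ has a $\mu^{\mathrm{op}}$-like base. *)

(* Defs.v *)
From HB Require Import structures.
From mathcomp Require Import all_boot all_order all_algebra.
From mathcomp Require Import all_classical all_reals all_analysis.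
From mathcomp Require Import Rstruct Rstruct_topology.
Set Implicit Arguments. Unset Strict Implicit. Unset Printing Implicit Defensive.
Import Order.TTheory GRing.Theory Num.Theory.
Local Open Scope classical_set_scope.

(* The Cantor cube 2^I : product (pointwise) topology of copies of the
   discrete two-point space bool, indexed by an arbitrary type I
   (the cardinal kappa is |I|). *)
Definition cantor_cube (I : Type) : Type := prod_topology (fun _ : I => bool).

Definition dyadic_compactum (X : topologicalType) : Prop :=
  compact [set: X] /\ hausdorff_space X /\
  exists (I : Type) (f : cantor_cube I -> X),
    continuous f /\ set_surj [set: cantor_cube I] [set: X] f.

Definition cozero_set (X : topologicalType) (U : set X) : Prop :=
  exists f : X -> Rdefinitions.R, continuous f /\ U = [set x | f x <> 0%R].

Definition is_base (X : topologicalType) (B : set_system X) : Prop :=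
  (forall U, B U -> open U) /\
  (forall V, open V -> forall x, V x -> exists2 U, B U & U x /\ U `<=` V).

(* omega^op-like: no member is contained in omega-many (infinitely many)
   members, i.e. each member has only finitely many supersets in the family. *)
Definition omega_op_like (X : Type) (B : set_system X) : Prop :=
  forall U, B U -> finite_set [set V | B V /\ U `<=` V].

Definition omega1_op_like (X : Type) (B : set_system X) : Prop :=
  forall U, B U -> countable [set V | B V /\ U `<=` V].

(* Nt(X) <= omega_1 : X has an omega_1^op-like base
   (mu^op-like implies nu^op-like for mu <= nu). *)
Definition Nt_le_omega1 (X : topologicalType) : Prop :=
  exists B : set_system X, is_base B /\ omega1_op_like B.

Definition Nt_eq_omega (X : topologicalType) : Prop :=
  exists B : set_system X, is_base B /\ omega_op_like B.

Definition Nt_eq_omega1 (X : topologicalType) : Prop :=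
  Nt_le_omega1 X /\ ~ Nt_eq_omega X.

(* Main.v *)
Require Import Defs.
From mathcomp Require Import all_boot all_order all_algebra.
From mathcomp Require Import all_classical all_reals all_analysis.
From mathcomp Require Import wochoice Rstruct Rstruct_topology.
Set Implicit Arguments. Unset Strict Implicit. Unset Printing Implicit Defensive.
Import Order.TTheory GRing.Theory Num.Theory.
Local Open Scope classical_set_scope.

(* Let [f] map 2^I onto X and let [B] be an omega_1^op-like base.  Countable
   elementary submodels are replaced by countable subsets [M] of (sets of
   X) + I closed under countably many finitary rules, arranged in a Davies
   tree: a well-ordered family in which the union of all predecessors of a
   member is a finite union of closed sets [N].

   From each [M s] take the sets of [A] lying inside a member of [B] that
   belongs to [M s] but to no earlier [M t].  They form a base: if [s] is least
   such that x has a neighbourhood U in [A] and [M s] inside a given open set,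
   pick W', W in [B] and [M s] with x in W', cl W' in W and W in U; an earlier
   [M t] containing W' would contain its superset W, hence an interpolating
   member of [A].  Such a set contains no nonempty open set of an earlier [M t],
   because the members of [B] in [M t] are upward closed in [B].  Conversely,
   for V nonempty and open, the sets of [A] in [N] containing V depend, when
   pulled back to 2^I, only on coordinates in [N], so that they all contain one
   nonempty open set of [N]; by induction only finitely many of them were
   chosen.  Within a single countable [M s], a metrizable-style thinning
   leaves finitely many supersets of each nonempty set of [M s]. *)

(** * Closure under countably many finitary rules *)

Lemma countable_seq (T : choiceType) (D : set T) :
  countable D -> countable [set s : seq T | [set` s] `<=` D].
Proof.
move=> /countable_injP[e einj]; apply/countable_injP.
exists (fun s => pickle (map e s)) => s t; rewrite !inE /= => sD tD.
move=> /(pcan_inj (@pickleK _)); elim: s t sD tD => [|x s IH] [|y t] //= sD tD.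
have Dx : x \in D by rewrite inE; apply: sD; rewrite /= mem_head.
have Dy : y \in D by rewrite inE; apply: tD; rewrite /= mem_head.
case=> /(einj _ _ Dx Dy) -> /IH -> //= z zs.
- by apply: sD; rewrite /= inE zs orbT.
- by apply: tD; rewrite /= inE zs orbT.
Qed.

Section RuleClosure.
Variables (T : choiceType) (R : seq T -> set T).

(** One map [R] packs all the rules: [R s] collects their outputs on the arguments [s]. *)
Definition rule_closed (M : set T) := forall s, [set` s] `<=` M -> R s `<=` M.

Definition rule_closure (Z : set T) : set T :=
  [set w | forall M, rule_closed M -> Z `<=` M -> M w].

Lemma sub_rule_closure Z : Z `<=` rule_closure Z.
Proof. by move=> w Zw M _; exact. Qed.

Lemma rule_closureP Z : rule_closed (rule_closure Z).
Proof.
move=> s sZ w Rw M Mc ZM; apply: (Mc s) => // x xs.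
exact: (sZ x xs).
Qed.

Lemma rule_closure_min Z M : rule_closed M -> Z `<=` M -> rule_closure Z `<=` M.
Proof. by move=> Mc ZM w; exact. Qed.

Lemma rule_closureS Z Z' : Z `<=` Z' -> rule_closure Z `<=` rule_closure Z'.
Proof.
move=> ZZ'; apply: rule_closure_min; first exact: rule_closureP.
exact: subset_trans (@sub_rule_closure _).
Qed.

(** The elements generated by finite parts of [Z] already form a closed set: the finite parts used
    for the arguments of one rule are concatenated. *)
Lemma rule_closure_finitary Z w : rule_closure Z w ->
  exists2 s : seq T, [set` s] `<=` Z & rule_closure [set` s] w.
Proof.
move=> Zw; apply: (Zw [set w | exists2 s : seq T, [set` s] `<=` Z &
  rule_closure [set` s] w]); last first.
  move=> z Zz; exists [:: z]; first by move=> y /=; rewrite inE => /eqP ->.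
  by apply: sub_rule_closure; rewrite /= mem_head.
move=> s sP {w Zw}w Rw.
suff [r rZ sr] : exists2 r : seq T, [set` r] `<=` Z & [set` s] `<=` rule_closure [set` r].
  by exists r => //; exact: rule_closureP sr _ Rw.
elim: s sP {Rw} => [|x s IH] sP; first by exists [::].
have [|r rZ sr] := IH; first by move=> y ys; apply: sP; rewrite /= inE ys orbT.
have [|r' r'Z xr'] := sP x; first by rewrite /= mem_head.
exists (r ++ r').
  by move=> y /=; rewrite mem_cat => /orP[/rZ|/r'Z].
move=> y /=; rewrite inE => /orP[/eqP ->|ys].
  by apply: rule_closureS xr' => z /= zr; rewrite mem_cat zr orbT.
by apply: rule_closureS (sr y ys) => z /= zr; rewrite mem_cat zr.
Qed.

(** The stages [C n] add outputs one round at a time; a finite sequence from their union lies in a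
    single stage, so the union is closed. *)
Lemma rule_closure_countable Z : (forall s, countable (R s)) ->
  countable Z -> countable (rule_closure Z).
Proof.
move=> Rc Zc.
pose C := fix C n := if n is m.+1
  then C m `|` \bigcup_(s in [set s : seq T | [set` s] `<=` C m]) R s else Z.
have CS m n : (m <= n)%N -> C m `<=` C n.
  elim: n => [|n IH]; first by rewrite leqn0 => /eqP ->.
  by rewrite leq_eqVlt => /orP[/eqP -> //|/IH mn] x /mn; left.
have Cc n : countable (C n).
  elim: n => // n IH /=.
  rewrite -bigcup2E; apply: bigcup_countable => // -[|[|k]] _ //=.
  by apply: bigcup_countable => //; exact: countable_seq.
have : countable (\bigcup_n C n) by exact: bigcup_countable.
apply: sub_countable; apply: subset_card_le.
apply: rule_closure_min; last by move=> z Zz; exists 0.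
move=> s sC w Rw.
suff [n sn] : exists n, [set` s] `<=` C n.
  by exists n.+1 => //; right; exists s.
elim: s sC {Rw} => [|x s IH] sC; first by exists 0.
have [|n sn] := IH; first by move=> y ys; apply: sC; rewrite /= inE ys orbT.
have [|m _ xm] := sC x; first by rewrite /= mem_head.
exists (maxn m n) => y /=; rewrite inE => /orP[/eqP ->|/sn].
- exact: CS (leq_maxl _ _) _ xm.
- exact: CS (leq_maxr _ _) _.
Qed.

End RuleClosure.

(** * Well-orders, descending sequences and the Davies tree *)

(** In the relation [R] every nonempty predicate has a unique least element. Pairs give totality and
    antisymmetry, triples transitivity, and a least inaccessible point well-foundedness. *)
Lemma strict_well_order (T : eqType) : exists lt : rel T,
  [/\ well_founded lt, transitive lt & forall x y, [|| lt x y, x == y | lt y x]].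
Proof.
have [R wo] := well_ordering_principle T.
have tot x y : R x y || R y x.
  have [|z [[]]] := wo (pred2 x y); first by exists x; rewrite inE eqxx.
  rewrite inE => /orP[]/eqP -> lb _; apply/orP; [left|right]; apply: lb;
  by rewrite inE eqxx ?orbT.
have rxx x : R x x by have := tot x x; rewrite orbb.
have anti x y : R x y -> R y x -> x = y.
  move=> xy yx; have [|z [_ u]] := wo (pred2 x y).
    by exists x; rewrite inE eqxx.
  transitivity z; [symmetry|]; apply: u; split; rewrite ?inE ?eqxx ?orbT // => w.
    by rewrite inE => /orP[]/eqP ->.
  by rewrite inE => /orP[]/eqP ->.
exists (fun x y => R x y && (x != y)); split.
- apply: contrapT => /existsNP[x xN].
  have [|z [[]]] := wo (fun x => ~~ `[< Acc (fun x y => R x y && (x != y)) x >]).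
    by exists x; apply/negP => /asboolP.
  rewrite -topredE /= => /asboolPn zN lb _; apply: zN; constructor => y /andP[yz nyz].
  apply: contrapT => yN; have /lb zy : y \in
    (fun x => ~~ `[< Acc (fun x y => R x y && (x != y)) x >]).
    by apply/negP => /asboolP.
  by move: nyz; rewrite (anti _ _ yz zy) eqxx.
- move=> y x z /andP[xy nxy] /andP[yz nyz].
  have [|w [[]]] := wo (pred3 x y z); first by exists x; rewrite inE eqxx.
  have m3 : [/\ x \in pred3 x y z, y \in pred3 x y z & z \in pred3 x y z].
    by rewrite !inE !eqxx !orbT.
  case: m3 => mx my mz.
  rewrite inE => /or3P[]/eqP -> lb _.
  + rewrite lb //=; apply: contra_neq nyz => xz; apply: anti => //.
    by rewrite -xz.
  + by move: nxy; rewrite (anti _ _ xy (lb _ mx)) eqxx.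
  + by move: nyz; rewrite (anti _ _ yz (lb _ my)) eqxx.
- move=> x y; case: eqVneq => //= nxy; rewrite ?orbT // andbT.
  by rewrite ?andbT; exact: tot.
Qed.

Section Lexicographic.
Variables (T : eqType) (lt : rel T).
Hypotheses (lt_wf : well_founded lt) (lt_trans : transitive lt).
Hypothesis lt_tot : forall x y, [|| lt x y, x == y | lt y x].

Definition descending : pred (seq T) := pairwise (fun x y => lt y x).

Fixpoint lex (t s : seq T) : bool :=
  match t, s with
  | _, [::] => false
  | [::], _ :: _ => true
  | x :: t', y :: s' => lt x y || (x == y) && lex t' s'
  end.

Lemma lex_total t s : [\/ lex t s, t = s | lex s t].
Proof.
elim: t s => [|x t IH] [|y s] /=; try by constructor.
have [xy|/eqP <-|yx] := or3P (lt_tot x y).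
- by rewrite xy; constructor.
- rewrite eqxx /=; have [->|->|->] := IH s; rewrite ?orbT; by constructor.
- by rewrite yx; constructor.
Qed.

Lemma lexP t s : reflect
  (exists p z v, s = p ++ z :: v /\
     (t = p \/ exists u w, t = p ++ u :: w /\ lt u z)) (lex t s).
Proof.
apply: (iffP idP).
  elim: t s => [|x t IH] [|y s] //=; first by exists [::], y, s; split; [|left].
  move=> /orP[xy|/andP[/eqP <- /IH]].
    by exists [::], y, s; split=> //; right; exists x, t.
  move=> [p [z [v [-> H]]]]; exists (x :: p), z, v; split=> //.
  case: H => [->|[u [w [-> uz]]]]; first by left.
  by right; exists u, w.
move=> [p [z [v [-> H]]]]; elim: p t H => [|x p IH] t.
  by case=> [->|[u [w [-> uz]]]] //=; rewrite uz.
case=> [->|[u [w [-> uz]]]] /=; rewrite eqxx /= IH ?orbT //; first by left.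
by right; exists u, w.
Qed.

Lemma descending_tail p z v : descending (p ++ z :: v) -> {in v, forall x, lt x z}.
Proof.
rewrite /descending pairwise_cat /= => /and3P[_ _ /andP[/allP zv _]] x.
exact: zv.
Qed.

Let lexd t s := descending t && lex t s.

Let below z := forall p, Acc lexd p -> forall q, descending (p ++ q) ->
  {in q, forall x, lt x z} -> Acc lexd (p ++ q).

(** A descending predecessor of [p ++ [:: z]] either departs inside [p], hence precedes [p], or
    continues [p] by entries below [z], possibly none. *)
Let Acc_rcons z p : below z -> Acc lexd p -> Acc lexd (p ++ [:: z]).
Proof.
move=> bz Ap; constructor => t /andP[td /lexP[p' [z' [v [E H]]]]].
have /orP [/eqP v0|vN0] := orbN (v == [::]).
  move: E; rewrite v0 !cats1 => /rcons_inj[Ep Ez]; subst p' z'.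
  case: H => [->//|[u [w [tE uz]]]]; rewrite tE in td *; apply: bz => // x.
  rewrite inE => /orP[/eqP -> //|/(descending_tail td) xu].
  exact: lt_trans xu uz.
have [v' [y vE]] : exists v' y, v = rcons v' y.
  by case/lastP: v vN0 {E} => // v' y _; exists v', y.
move: E; rewrite vE -rcons_cons -rcons_cat cats1 => /rcons_inj[Ep _].
apply: (Acc_inv Ap); rewrite /lexd td /= Ep; apply/lexP.
by exists p', z', v'.
Qed.

Let belowP z : below z.
Proof.
elim/(well_founded_ind lt_wf): z => z IH p Ap [|y q] d qz; first by rewrite cats0.
have yz : lt y z by apply: qz; rewrite mem_head.
(* The first entry [y] joins the prefix; by descent the rest of [q] lies below [y]. *)
rewrite -cat1s catA; apply: (IH y yz).
- exact: Acc_rcons (IH y yz) Ap.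
- by rewrite -catA.
- exact: descending_tail d.
Qed.

(** Descending sequences compare like ordinals $\sum 2^z$ over their entries $z$. Without descent
    the order could fail to be well-founded, as in $1, 01, 001, \dots$ *)
Lemma lex_wf : well_founded (fun t s : {s | descending s} => lex (val t) (val s)).
Proof.
suff H s : Acc lexd s -> forall d : {s | descending s}, val d = s ->
    Acc (fun t s : {s | descending s} => lex (val t) (val s)) d.
  case=> -[|x s] d; apply: (H _ _ _ erefl); first by constructor=> -[|? ?] /andP[].
  apply: (@belowP x [:: x] _ s d); last exact: (@descending_tail [::]).
  apply: (@Acc_rcons x [::]); first exact: belowP.
  by constructor=> -[|? ?] /andP[].
elim=> {}s _ IH d ds; constructor => t ltt; apply: (IH (val t)) => //.
by rewrite /lexd (valP t) -ds.
Qed.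

(** Insertion sort turns finitely many generators below [z] into a single index that precedes every
    sequence beginning with [rcons p z]. *)
Lemma descending_insert z (p r : seq T) : descending (rcons p z) ->
  {in r, forall x, lt x z} ->
  exists2 q, descending (p ++ q) & {subset r <= q} /\ {in q, forall x, lt x z}.
Proof.
move=> dpz rz.
have pz : {in p, forall x, lt z x}.
  move: dpz; rewrite /descending -cats1 pairwise_cat allrel1r => /and3P[/allP].
  by [].
have dp : descending p.
  by move: dpz; rewrite /descending -cats1 pairwise_cat => /and3P[].
suff [q dq [rq qz]] : exists2 q, descending q &
    {subset r <= q} /\ {in q, forall x, lt x z}.
  exists q; [|by split]; rewrite /descending pairwise_cat.
  apply/and3P; split=> //; apply/allrelP => x y /pz zx /qz yz.
  exact: lt_trans yz zx.
elim: r rz => [|x r IH] rz; first by exists [::].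
have [|q dq [rq qz]] := IH; first by move=> y yr; apply: rz; rewrite inE yr orbT.
have xz : lt x z by apply: rz; rewrite mem_head.
have [xq|xNq] := boolP (x \in q).
  by exists q => //; split=> // y; rewrite inE => /orP[/eqP -> //|/rq].
pose q1 := [seq y <- q | lt x y]; pose q2 := [seq y <- q | ~~ lt x y].
have q2x : {in q2, forall y, lt y x}.
  move=> y; rewrite mem_filter => /andP[xy yq].
  have /or3P[|/eqP yx|] := lt_tot y x => //; last by rewrite (negbTE xy).
  by rewrite -yx yq in xNq.
have q1x : {in q1, forall y, lt x y} by move=> y; rewrite mem_filter => /andP[].
exists (q1 ++ x :: q2).
  rewrite /descending pairwise_cat /= !(subseq_pairwise _ dq) ?filter_subseq //.
  rewrite !andbT; apply/andP; split; last by apply/allP.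
  apply/allrelP => u v /q1x xu; rewrite inE => /orP[/eqP -> //|/q2x vx].
  exact: lt_trans vx xu.
have qE y : (y \in q1 ++ x :: q2) = (y == x) || (y \in q).
  rewrite mem_cat inE !mem_filter; case: (lt x y); rewrite /= ?orbF ?andbF.
    by rewrite orbC.
  by [].
split=> y; rewrite qE.
  by rewrite inE => /orP[->//|/rq ->]; rewrite orbT.
by move=> /orP[/eqP -> //|/qz].
Qed.

End Lexicographic.

(* A Davies tree: [M s] is the closure of a finite set listed in decreasing
   order [s], the index being ordered lexicographically.  If [t] precedes [s]
   then [t] agrees with [s] up to some entry [z] of [s], after which it stays
   below [z]; so the union of the earlier [M t] is the union, over the entries
   [z] of [s], of the closures of (entries before [z]) + (everything below [z]). *)
Theorem davies_tree (T : choiceType) (R : seq T -> set T) :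
  (forall s, countable (R s)) ->
  exists (L : Type) (lt : L -> L -> Prop) (M : L -> set T),
  [/\ well_founded lt, forall s t, [\/ lt s t, s = t | lt t s],
      forall s, rule_closed R (M s) /\ countable (M s),
      forall w, exists s, M s w &
      forall s, exists (n : nat) (N : nat -> set T),
        (forall j, rule_closed R (N j)) /\
        forall w, (exists2 t, lt t s & M t w) <-> (exists2 j, (j < n)%N & N j w)].
Proof.
move=> Rc; have [lt [lt_wf lt_trans lt_tot]] := strict_well_order T.
exists {s | descending lt s}, (fun t s => lex lt (val t) (val s)).
exists (fun s => rule_closure R [set` val s]); split.
- exact: lex_wf.
- move=> s t; have [H|/val_inj H|H] := lex_total lt_tot (val s) (val t);
  by [constructor 1|constructor 2|constructor 3].
- move=> s; split; first exact: rule_closureP.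
  apply: rule_closure_countable => //.
  exact/finite_set_countable/finite_seq.
- move=> w; have d : descending lt [:: w] by [].
  exists (exist (fun s => descending lt s) [:: w] d).
  by apply: sub_rule_closure; rewrite /= mem_head.
move=> s; exists (size (val s)).
(* [ohead (drop j _)] reads the [j]-th entry without requiring a default element of [T]. *)
exists (fun j => rule_closure R ([set` take j (val s)] `|`
  [set x | exists2 z, ohead (drop j (val s)) = Some z & lt x z])).
split=> [j|w]; first exact: rule_closureP.
split.
  move=> [[t dt] /= /lexP[p [z [v [sE H]]]] tw].
  exists (size p); first by rewrite sE size_cat /= addnS ltnS leq_addr.
  rewrite sE take_size_cat // drop_size_cat //; apply: rule_closureS tw.
  move=> x /= xt; case: H => [<-|[u [y [tE uz]]]]; first by left.
  move: xt; rewrite tE mem_cat inE => /or3P[xp|/eqP ->|xy]; first by left.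
    by right; exists z.
  right; exists z => //; apply: lt_trans uz.
  by rewrite tE in dt; exact: descending_tail dt _ xy.
move=> [j js]; set p := take j (val s).
have : drop j (val s) <> [::].
  by move=> /(congr1 size) /eqP; rewrite size_drop subn_eq0 leqNgt js.
(* Finitely many generators [r] suffice for [w]. Those outside [p] lie below [z] and are sorted
   behind [p], which gives an index before [s]. *)
case E : (drop j (val s)) => [|z v] // _ /rule_closure_finitary[r rN rw].
have sE : val s = p ++ z :: v by rewrite -E cat_take_drop.
have dpz : descending lt (rcons p z).
  have := valP s; rewrite /= sE -cat_rcons /descending pairwise_cat.
  by move=> /and3P[].
have [|q dq [rq qz]] := @descending_insert _ _ lt_trans lt_tot z p
  [seq x <- r | x \notin p] dpz.
  move=> x; rewrite mem_filter => /andP[xp xr].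
  by have [|[y [<-]]] := rN x xr => //; rewrite /= (negbTE xp).
exists (exist (fun s => descending lt s) (p ++ q) dq) => /=.
  apply/lexP; exists p, z, v; split=> //.
  case: q dq rq qz => [|u q] dq rq qz; [left|right].
    by rewrite cats0.
  by exists u, q; split=> //; apply: qz; rewrite mem_head.
apply: rule_closureS rw => x /= xr; rewrite mem_cat.
by have [//|xp] := boolP (x \in p); rewrite rq // mem_filter xp.
Qed.

(** * Compactness and cozero sets *)

(** Without a finite subcover, the complements in [K] of finite unions generate a proper filter; its
    cluster point in [K] could lie in no member of [P]. *)
Lemma compact_finite_cover (X : topologicalType) (K : set X) (P : set (set X)) :
  compact K -> (forall U, P U -> open U) ->
  (forall x, K x -> exists2 U, P U & U x) ->
  exists2 s : seq (set X), [set` s] `<=` P &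
    forall x, K x -> exists2 U, U \in s & U x.
Proof.
move=> Kc Po KP; apply: contrapT => Nfin.
pose F := filter_from [set s : seq (set X) | [set` s] `<=` P]
  (fun s => K `&` [set x | forall U, U \in s -> ~ U x]).
have FF : ProperFilter F.
  apply: filter_from_proper.
    apply: filter_from_filter; first by exists [::].
    move=> s t /= sP tP; exists (s ++ t).
      by move=> U /=; rewrite mem_cat => /orP[/sP|/tP].
    move=> x [Kx xst]; split; split=> // U Us; apply: xst; rewrite mem_cat Us //.
    by rewrite orbT.
  move=> s sP; apply: contrapT => sN; apply: Nfin; exists s => // x Kx.
  apply: contrapT => xN; apply: sN; exists x; split=> // U Us Ux.
  by apply: xN; exists U.
have [|x [Kx xF]] := Kc F FF; first by exists [::] => // x [].
have [U PU Ux] := KP x Kx.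
have [||y [[_ yN] Uy]] := xF (K `&` [set x | ~ U x]) U.
- exists [:: U]; first by move=> V /=; rewrite inE => /eqP ->.
  by move=> y [Ky yN]; split=> //; apply: yN; rewrite mem_head.
- by apply: open_nbhs_nbhs; split=> //; exact: Po.
exact: yN.
Qed.

Lemma cozero_open (X : topologicalType) (U : set X) : cozero_set U -> open U.
Proof.
move=> [f [fc ->]]; rewrite (_ : mkset _ = f @^-1` [set y | y != 0%R]).
  by apply: open_comp; [move=> x _; exact: fc|exact: open_neq].
by apply/seteqP; split=> x /eqP.
Qed.

(** The levels $|f|\ge 1/(n+1)$ exhaust the set. Through these countably many compact pieces, rules
    with countable output can handle a whole member of [A]. *)
Lemma cozero_sigma_compact (X : topologicalType) (U : set X) :
  compact [set: X] -> cozero_set U ->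
  exists K : nat -> set X, (forall n, compact (K n)) /\ U = \bigcup_n K n.
Proof.
move=> Xc [f [fc ->]].
exists (fun n => f @^-1` [set y | (n.+1%:R^-1 <= `|y|)%R]); split=> [n|].
  apply: (subclosed_compact _ Xc) => //.
  apply: preimage_closed; first by move=> x _; exact: fc.
  rewrite (_ : mkset _ = [set y | (n.+1%:R^-1 <= y)%R] `|`
                         [set y | (y <= - n.+1%:R^-1)%R]).
    by apply: closedU; [exact: closed_ge|exact: closed_le].
  by apply/seteqP; split=> y /=; rewrite ler_normr lerNr => /orP.
apply/seteqP; split=> [x /= fx0|x [n _] /= le0 fx0]; last first.
  by move: le0; rewrite fx0 normr0 leNgt invr_gt0 ltr0Sn.
have fx : (0 < `|f x|)%R by rewrite normr_gt0; apply/eqP.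
have [n _ nP] := near_infty_natSinv_lt (PosNum fx).
by exists n => //=; apply: ltW; apply: (nP n) => /=.
Qed.

(** Urysohn functions separate a point from a closed set. This provides a base for the second claim
    of the theorem, where none is given. *)
Lemma cozero_base (X : topologicalType) :
  compact [set: X] -> hausdorff_space X -> is_base (@cozero_set X).
Proof.
move=> Xc XT2; split=> [U|V Vo x Vx]; first exact: cozero_open.
have [|f [fc _ f0 f1]] := (@uniform_separatorP _ Rdefinitions.R (~` V) [set x]).1.
  apply: normal_uniform_separator; [exact: compact_normal|exact: open_closedC| |].
    exact/accessible_closed_set1/hausdorff_accessible.
  by apply/disjoints_subset => y Vy /= yx; apply: Vy; rewrite yx.
exists [set y | f y <> 0%R]; first by exists f.
split=> [|y fy] /=.
  have -> : f x = 1%R by apply: f1; exists x.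
  exact/eqP/oner_neq0.
by apply: contrapT => Vy; apply: fy; apply: f0; exists y.
Qed.

Lemma base_closure (X : topologicalType) (A : set_system X) :
  compact [set: X] -> hausdorff_space X -> is_base A ->
  forall V x, open V -> V x -> exists U, [/\ A U, U x & closure U `<=` V].
Proof.
move=> Xc XT2 [Ao Ab] V x Vo Vx.
have [W Wx WV] : filter_from (nbhs x) closure V.
  apply: (compact_regular XT2 Xc); first exact: filterT.
  exact: open_nbhs_nbhs.
have [U AU [Ux UW]] := Ab _ (open_interior W) x Wx.
exists U; split=> //; apply: subset_trans WV; apply: closureS.
exact: subset_trans (@interior_subset _ _).
Qed.

(** * Basic open sets of the Cantor cube *)

Section CantorCube.
Variable I : choiceType.

(** A list may prescribe contradictory values and then gives the empty set, whence the nonemptiness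
    clauses later on. *)
Definition box (b : seq (I * bool)) : set (cantor_cube I) :=
  [set y | forall i : I * bool, i \in b -> y i.1 = i.2].

Lemma cantor_cube_compact : compact [set: cantor_cube I].
Proof.
have := @tychonoff I (fun=> bool) (fun=> setT) (fun=> bool_compact).
by congr compact; apply/seteqP; split.
Qed.

Lemma box_open b : open (box b).
Proof.
elim: b => [|[i c] b IH].
  suff -> : box [::] = setT by exact: openT.
  by apply/seteqP; split.
have -> : box ((i, c) :: b) = proj i @^-1` [set c] `&` box b.
  apply/seteqP; split=> y /=.
    move=> H; split; first by have := H (i, c); rewrite mem_head; exact.
    by move=> j jb; apply: H; rewrite inE jb orbT.
  by move=> [yi yb] j; rewrite inE => /orP[/eqP -> //|]; exact: yb.
apply: openI => //; apply: open_comp => [y _|]; last exact: discrete_open.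
exact: proj_continuous.
Qed.

(** The filter generated by the boxes around [y] converges to [y] in each coordinate, hence in the
    product topology. *)
Lemma box_nbhs (G : set (cantor_cube I)) y : nbhs y G ->
  exists2 b, box b y & box b `<=` G.
Proof.
pose F := filter_from [set b | box b y] box.
have FF : Filter F.
  apply: filter_from_filter; first by exists [::].
  move=> b c /= yb yc; exists (b ++ c).
    by move=> i; rewrite mem_cat => /orP[/yb|/yc].
  by move=> z zbc; split=> i ib; apply: zbc; rewrite mem_cat ib ?orbT.
suff : F --> y by move=> /[apply] -[b]; exists b.
apply/cvg_sup => i; move=> V [_ [[W Wo <-] /= Wy WV]].
exists [:: (i, y i)].
  by move=> j; rewrite inE => /eqP ->.
move=> z /(_ (i, y i)); rewrite mem_head => /(_ isT) /= zi; apply: WV => /=.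
by rewrite zi.
Qed.

Lemma cube_compact_box_cover (K G : set (cantor_cube I)) :
  compact K -> open G -> K `<=` G ->
  exists2 bs : seq (seq (I * bool)),
    forall b, b \in bs -> box b !=set0 /\ box b `<=` G &
    forall y, K y -> exists2 b, b \in bs & box b y.
Proof.
move=> Kc Go KG.
have [|y Ky|s sP sK] := @compact_finite_cover _ K
    [set U | exists b, [/\ U = box b, box b !=set0 & box b `<=` G]] Kc.
- by move=> _ [b [-> _ _]]; exact: box_open.
- have [|b yb bG] := @box_nbhs G y; first by apply: open_nbhs_nbhs; split=> //; exact: KG.
  by exists (box b) => //; exists b; split=> //; exists y.
have [g gP] : {g : set (cantor_cube I) -> seq (I * bool) & forall U, U \in s ->
    [/\ U = box (g U), box (g U) !=set0 & box (g U) `<=` G]}.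
  apply: (@choice _ _ (fun U b => U \in s ->
    [/\ U = box b, box b !=set0 & box b `<=` G])) => U.
  have [/sP[b bP]|] := boolP (U \in s); [by exists b|by exists [::]].
exists (map g s).
  by move=> _ /mapP[U Us ->]; have [] := gP _ Us.
move=> y /sK[U Us Uy]; exists (g U); first exact: map_f.
by have [<-] := gP _ Us.
Qed.

End CantorCube.

(** * Properties enforced by countably many rules *)

Section Rules.
Variable T : choiceType.

(** A substitute for the Lowenheim-Skolem theorem: closing a countable set under [R] yields a
    countable set with property [P]. *)
Definition ruled (P : set T -> Prop) := exists2 R : seq T -> set T,
  forall s, countable (R s) & forall M, rule_closed R M -> P M.

Lemma ruledI P Q : ruled P -> ruled Q -> ruled (fun M => P M /\ Q M).
Proof.
move=> [R Rc RP] [R' R'c R'Q]; exists (fun s => R s `|` R' s).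
  by move=> s; rewrite -bigcup2E; apply: bigcup_countable => // -[|[|k]] _ /=.
move=> M Mc; split; [apply: RP|apply: R'Q] => s sM w Rw; apply: (Mc s sM).
  by left.
by right.
Qed.

Lemma ruledW (P Q : set T -> Prop) : (forall M, P M -> Q M) -> ruled P -> ruled Q.
Proof. by move=> PQ [R Rc RP]; exists R => // M /RP/PQ. Qed.

(** The sets [C] act as Skolem functions with countable values. Since [enc] is injective, each
    sequence codes at most one [j], so the outputs stay countable. *)
Lemma ruled_family (J : Type) (enc : J -> seq T) (Q : J -> set T -> Prop) :
  injective enc -> (forall j, exists2 C, countable C & Q j C) ->
  ruled (fun M => forall j, [set` enc j] `<=` M -> exists2 C, C `<=` M & Q j C).
Proof.
move=> enc_inj QC.
have [C CP] : {C : J -> set T & forall j, countable (C j) /\ Q j (C j)}.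
  apply: (@choice _ _ (fun j C => countable C /\ Q j C)) => j.
  by have [C] := QC j; exists C.
exists (fun s => \bigcup_(j in [set j | enc j = s]) C j).
  move=> s; apply: bigcup_countable => [|j _]; last by have [] := CP j.
  apply/countable_injP; exists (fun=> 0%N) => i j; rewrite !inE /= => <- ji _.
  exact: enc_inj.
move=> M Mc j jM; exists (C j); last by have [] := CP j.
by apply: subset_trans (Mc _ jM); exact: (bigcup_sup (i := j)).
Qed.

End Rules.

Lemma countable_image T U (g : T -> U) (C : set T) : countable C -> countable (g @` C).
Proof. exact: sub_countable (card_image_le _ _). Qed.

Lemma compact_countable_cover (X : topologicalType) (J : countType)
    (K : J -> set X) (P : set (set X)) :
  (forall j, compact (K j)) -> (forall U, P U -> open U) ->
  (forall j x, K j x -> exists2 U, P U & U x) ->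
  exists C, [/\ countable C, C `<=` P & forall j x, K j x -> exists2 U, C U & U x].
Proof.
move=> Kc Po KP.
have [s sP] : {s : J -> seq (set X) & forall j, [set` s j] `<=` P /\
    forall x, K j x -> exists2 U, U \in s j & U x}.
  apply: (@choice _ _ (fun j s => [set` s] `<=` P /\
    forall x, K j x -> exists2 U, U \in s & U x)) => j.
  by have [s] := compact_finite_cover (Kc j) Po (KP j); exists s.
exists (\bigcup_j [set` s j]); split.
- by apply: bigcup_countable => // j _; exact/finite_set_countable/finite_seq.
- by move=> U [j _]; have [sjP _] := sP j; exact: sjP.
- move=> j x Kx; have [_ /(_ x Kx)[U Us Ux]] := sP j.
  by exists U => //; exists j.
Qed.

(** * Reflection: rules for [A], [B] and the coordinates *)

Section Reflection.
Variables (X : topologicalType) (A B : set_system X).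
Variables (I : choiceType) (f : cantor_cube I -> X).
Hypotheses (Xc : compact [set: X]) (XT2 : hausdorff_space X).
Hypotheses (fc : continuous f) (fsurj : set_surj [set: cantor_cube I] [set: X] f).
Hypotheses (Abase : is_base A) (Acozero : forall U, A U -> cozero_set U).
Hypotheses (Bbase : is_base B) (Bop : omega1_op_like B).

Let T : choiceType := (set X + I)%type.

Definition boxes (bs : seq (seq (I * bool))) : set (cantor_cube I) :=
  \bigcup_(b in [set` bs]) box b.

(* The consequences of elementarity of a submodel [M] that the proof uses. *)
Record reflecting (M : set T) : Prop := Reflecting {
  refl_up : forall V W, B V -> M (inl V) -> B W -> V `<=` W -> M (inl W);
  refl_interpolate : forall V W x, B V -> M (inl V) -> B W -> M (inl W) ->
    closure V `<=` W -> V x -> exists U, [/\ A U, M (inl U), U x & U `<=` W];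
  refl_meet : forall U V x, A U -> M (inl U) -> A V -> M (inl V) -> U x -> V x ->
    exists W, [/\ A W, M (inl W), W x & closure W `<=` U `&` V];
  refl_chain : forall U x, A U -> M (inl U) -> U x -> exists U' W' W,
    [/\ A U', M (inl U') & U' x] /\ [/\ B W', M (inl W') & U' `<=` W'] /\
    [/\ B W, M (inl W), closure W' `<=` W & W `<=` U];
  refl_support : forall U (y z : cantor_cube I), A U -> M (inl U) ->
    (forall i, M (inr i) -> y i = z i) -> U (f y) -> U (f z);
  refl_boxes : forall (bs : seq (seq (I * bool))) V,
    (forall b ic, b \in bs -> ic \in b -> M (inr ic.1)) ->
    open V -> V !=set0 -> V `<=` f @` boxes bs ->
    exists U, [/\ A U, M (inl U), U !=set0 & U `<=` f @` boxes bs];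
  refl_split : forall U x, A U -> M (inl U) -> U !=set0 ->
    exists C, [/\ A C, M (inl C), C x & ~ (U `<=` C) \/ exists p, C = [set p]]
}.

Let Aopen U : A U -> open U. Proof. exact: Abase.1. Qed.
Let Bopen U : B U -> open U. Proof. exact: Bbase.1. Qed.

Let enc1 (U : set X) : seq T := [:: inl U].
Let enc2 (UV : set X * set X) : seq T := [:: inl UV.1; inl UV.2].

Let enc1_inj : injective enc1. Proof. by move=> U V []. Qed.
Let enc2_inj : injective enc2. Proof. by move=> [U V] [U' V'] [-> ->]. Qed.

Let enc1P (M : set T) U : M (inl U) -> [set` enc1 U] `<=` M.
Proof. by move=> MU w /=; rewrite inE => /eqP ->. Qed.

Let enc2P (M : set T) U V : M (inl U) -> M (inl V) -> [set` enc2 (U, V)] `<=` M.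
Proof. by move=> MU MV w /=; rewrite !inE => /orP[]/eqP ->. Qed.

(** Here the $\omega_1^{\mathrm{op}}$-like hypothesis enters: all supersets in [B] of one member
    form a countable output. *)
Let ruled_up : ruled (fun M : set T => forall V W,
  B V -> M (inl V) -> B W -> V `<=` W -> M (inl W)).
Proof.
apply: ruledW (ruled_family (enc := enc1) (Q := fun V C => B V -> forall W,
   B W -> V `<=` W -> C (inl W)) enc1_inj _).
  by move=> M H V W BV MV BW VW; have [C CM] := H V (enc1P MV); move=> /(_ BV W BW VW)/CM.
move=> V; have [BV|NBV] := pselect (B V); last by exists set0.
exists (inl @` [set W | B W /\ V `<=` W]); first exact/countable_image/Bop.
by move=> _ W BW VW; exists W.
Qed.

(** The compact set [closure V] is covered by finitely many members of [A] inside [W]. *)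
Let ruled_interpolate : ruled (fun M : set T => forall V W x,
    B V -> M (inl V) -> B W -> M (inl W) ->
    closure V `<=` W -> V x -> exists U, [/\ A U, M (inl U), U x & U `<=` W]).
Proof.
apply: ruledW (ruled_family (enc := enc2) (Q := fun VW C => B VW.2 ->
  closure VW.1 `<=` VW.2 -> forall x, VW.1 x ->
  exists U, [/\ A U, C (inl U), U x & U `<=` VW.2]) enc2_inj _).
  move=> M H V W x BV MV BW MW VW Vx; have [C CM] := H (V, W) (enc2P MV MW).
  by move=> /(_ BW VW x Vx)[U [AU /CM MU Ux UW]]; exists U.
move=> [V W] /=; have [[BW VW]|N] := pselect (B W /\ closure V `<=` W); last first.
  by exists set0 => // BW VW; case: N.
have [|||s sP sV] := @compact_finite_cover _ (closure V) [set U | A U /\ U `<=` W].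
- exact: subclosed_compact (@closed_closure _ _) Xc _.
- by move=> U [/Aopen].
- move=> x /VW Wx; have [U AU [Ux UW]] := Abase.2 _ (Bopen BW) _ Wx.
  by exists U.
exists (inl @` [set` s]); first exact/countable_image/finite_set_countable/finite_seq.
move=> _ _ x /subset_closure /sV[U Us Ux]; have [AU UW] := sP _ Us.
by exists U; split=> //; exists U.
Qed.

(** The intersection is the union of the compact sets $K_m\cap K'_n$, so countably many sets [W]
    cover it. *)
Let ruled_meet : ruled (fun M : set T => forall U V x,
    A U -> M (inl U) -> A V -> M (inl V) -> U x -> V x ->
    exists W, [/\ A W, M (inl W), W x & closure W `<=` U `&` V]).
Proof.
apply: ruledW (ruled_family (enc := enc2) (Q := fun UV C => A UV.1 -> A UV.2 ->
  forall x, UV.1 x -> UV.2 x ->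
  exists W, [/\ A W, C (inl W), W x & closure W `<=` UV.1 `&` UV.2]) enc2_inj _).
  move=> M H U V x AU MU AV MV Ux Vx; have [C CM] := H (U, V) (enc2P MU MV).
  by move=> /(_ AU AV x Ux Vx)[W [AW /CM MW Wx WUV]]; exists W.
move=> [U V] /=; have [[AU AV]|N] := pselect (A U /\ A V); last first.
  by exists set0 => // AU AV; case: N.
have [K [Kc UK]] := cozero_sigma_compact Xc (Acozero AU).
have [K' [K'c VK']] := cozero_sigma_compact Xc (Acozero AV).
have [|||C [Cc CP CK]] := @compact_countable_cover X (nat * nat)%type
    (fun j => K j.1 `&` K' j.2) [set W | A W /\ closure W `<=` U `&` V].
- by move=> j; apply: compact_closedI => //; exact: compact_closed.
- by move=> W [/Aopen].
- move=> j x [Kx K'x].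
  have [||W [AW Wx WUV]] := base_closure Xc XT2 Abase (V := U `&` V) (x := x).
  + by apply: openI; exact: Aopen.
  + by rewrite UK VK'; split; [exists j.1|exists j.2].
  by exists W.
exists (inl @` C); first exact: countable_image.
move=> _ _ x; rewrite {1}UK {1}VK' => -[m _ Kx] [n _ K'x].
have [W CW Wx] := CK (m, n) x (conj Kx K'x); have [AW WUV] := CP _ CW.
by exists W; split=> //; exists W.
Qed.

Let ruled_chain : ruled (fun M : set T => forall U x, A U -> M (inl U) -> U x ->
  exists U' W' W, [/\ A U', M (inl U') & U' x] /\
    [/\ B W', M (inl W') & U' `<=` W'] /\
    [/\ B W, M (inl W), closure W' `<=` W & W `<=` U]).
Proof.
apply: ruledW (ruled_family (enc := enc1) (Q := fun U C => A U ->
  forall x, U x -> exists U' W' W, [/\ A U', C (inl U') & U' x] /\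
    [/\ B W', C (inl W') & U' `<=` W'] /\
    [/\ B W, C (inl W), closure W' `<=` W & W `<=` U]) enc1_inj _).
  move=> M H U x AU MU Ux; have [C CM] := H U (enc1P MU).
  move=> /(_ AU x Ux)[U' [W' [W [[AU' /CM MU' U'x]]]]].
  move=> [[BW' /CM MW' UW'] [BW /CM MW W'W WU]].
  by exists U', W', W.
move=> U; have [AU|N] := pselect (A U); last by exists set0.
have [K [Kc UK]] := cozero_sigma_compact Xc (Acozero AU).
pose chain U' W := [/\ B W.1, U' `<=` W.1, B W.2, closure W.1 `<=` W.2 & W.2 `<=` U].
have [|||C [Cc CP CK]] := @compact_countable_cover X nat K
    [set U' | A U' /\ exists W, chain U' W].
- by [].
- by move=> W [/Aopen].
- move=> n x Kx; have Ux : U x by rewrite UK; exists n.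
  have [W BW [Wx WU]] := Bbase.2 _ (Aopen AU) _ Ux.
  have [W' [BW' W'x W'W]] := base_closure Xc XT2 Bbase (Bopen BW) Wx.
  have [U' AU' [U'x U'W']] := Abase.2 _ (Bopen BW') _ W'x.
  by exists U' => //; split=> //; exists (W', W).
(* Countably many [U'] cover [U]; fixing one pair from [B] for each keeps the output countable. *)
have [w wP] : {w : set X -> set X * set X & forall U', C U' -> chain U' (w U')}.
  apply: (@choice _ _ (fun U' W => C U' -> chain U' W)) => U'.
  have [/CP[_ [W]]|N] := pselect (C U'); first by exists W.
  by exists (set0, set0).
exists (\bigcup_(U' in C) [set inl U'; inl (w U').1; inl (w U').2]).
  by apply: bigcup_countable => // U' _; exact/finite_set_countable/finite_set3.
move=> _ x; rewrite {1}UK => -[n _ Kx].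
have [U' CU' U'x] := CK n x Kx; have [AU' _] := CP _ CU'.
have [Bw1 U'w1 Bw2 w12 w2U] := wP U' CU'.
exists U', (w U').1, (w U').2; do ?split=> //; exists U' => //.
- by left; left.
- by left; right.
- by right.
Qed.

(** The preimage of each compact piece of [U] is covered by finitely many boxes inside the preimage
    of [U]; [J] consists of the coordinates that all these boxes mention. *)
Lemma cozero_support (U : set X) : cozero_set U ->
  exists2 J : set I, countable J & forall y z : cantor_cube I,
    (forall i, J i -> y i = z i) -> U (f y) -> U (f z).
Proof.
move=> Uz; have [K [Kc UK]] := cozero_sigma_compact Xc Uz.
have fUo : open (f @^-1` U).
  by apply: open_comp; [move=> y _; exact: fc|exact: cozero_open].
have [bs bsP] : {bs : nat -> seq (seq (I * bool)) & forall n,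
    (forall b, b \in bs n -> box b !=set0 /\ box b `<=` f @^-1` U) /\
    (forall y, (f @^-1` K n) y -> exists2 b, b \in bs n & box b y)}.
  apply: (@choice _ _ (fun n bs =>
    (forall b, b \in bs -> box b !=set0 /\ box b `<=` f @^-1` U) /\
    (forall y, (f @^-1` K n) y -> exists2 b, b \in bs & box b y))) => n.
  have [|||bs] := @cube_compact_box_cover I (f @^-1` K n) (f @^-1` U); last by exists bs.
  - apply: subclosed_compact (@cantor_cube_compact I) _ => //.
    apply: preimage_closed; first by move=> y _; exact: fc.
    exact: compact_closed.
  - by [].
  - by move=> y Ky /=; rewrite UK; exists n.
exists (\bigcup_n [set` map fst (flatten (bs n))]).
  by apply: bigcup_countable => // n _; exact/finite_set_countable/finite_seq.
move=> y z yz; rewrite {1}UK => -[n _ Ky].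
have [bsU /(_ y Ky)[b bbs yb]] := bsP n.
have [_] := bsU b bbs; apply => ic icb; rewrite -yz; first exact: yb.
by exists n => //=; apply: map_f; apply/flattenP; exists b.
Qed.

Let ruled_support : ruled (fun M : set T => forall U (y z : cantor_cube I),
    A U -> M (inl U) ->
    (forall i, M (inr i) -> y i = z i) -> U (f y) -> U (f z)).
Proof.
apply: ruledW (ruled_family (enc := enc1) (Q := fun U C =>
    A U -> forall y z : cantor_cube I,
    (forall i, C (inr i) -> y i = z i) -> U (f y) -> U (f z)) enc1_inj _).
  move=> M H U y z AU MU yz; have [C CM] := H U (enc1P MU).
  by apply=> // i /CM; exact: yz.
move=> U; have [AU|N] := pselect (A U); last by exists set0.
have [J Jc JU] := cozero_support (Acozero AU).
exists (inr @` J); first exact: countable_image.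
by move=> _ y z yz; apply: JU => i Ji; apply: yz; exists i.
Qed.

(** The chosen [g bs] does not depend on [V], and only countably many lists of boxes use coordinates
    from a given finite [s]. *)
Let ruled_boxes : ruled (fun M : set T => forall (bs : seq (seq (I * bool))) V,
    (forall b ic, b \in bs -> ic \in b -> M (inr ic.1)) ->
    open V -> V !=set0 -> V `<=` f @` boxes bs ->
    exists U, [/\ A U, M (inl U), U !=set0 & U `<=` f @` boxes bs]).
Proof.
have [g gP] : {g : seq (seq (I * bool)) -> set X & forall bs V,
    open V -> V !=set0 -> V `<=` f @` boxes bs ->
    [/\ A (g bs), g bs !=set0 & g bs `<=` f @` boxes bs]}.
  apply: (@choice _ _ (fun bs U => forall V,
    open V -> V !=set0 -> V `<=` f @` boxes bs ->
    [/\ A U, U !=set0 & U `<=` f @` boxes bs])) => bs.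
  have [[V [Vo [x Vx] Vbs]]|N] := pselect (exists V,
      [/\ open V, V !=set0 & V `<=` f @` boxes bs]); last first.
    by exists set0 => V Vo V0 Vbs; case: N; exists V.
  have [U AU [Ux UV]] := Abase.2 _ Vo _ Vx.
  by exists U => *; split=> //; [exists x|exact: subset_trans Vbs].
have enc_inj : injective (map inr : seq I -> seq T) by apply: inj_map => i j [].
apply: ruledW (ruled_family (Q := fun s C => forall bs : seq (seq (I * bool)),
  (forall b ic, b \in bs -> ic \in b -> ic.1 \in s) -> C (inl (g bs))) enc_inj _).
  move=> M H bs V bsM Vo V0 Vbs.
  have [AU U0 Ubs] := gP _ _ Vo V0 Vbs; exists (g bs); split=> //.
  have [|C CM HC] := H (map fst (flatten bs)).
    move=> _ /= /mapP[_ /mapP[ic /flattenP[b bbs icb] ->] ->].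
    exact: bsM bbs icb.
  apply/CM/HC => b ic bbs icb; apply: map_f; apply/flattenP; by exists b.
move=> s; exists ((inl \o g) @` [set bs | [set` bs] `<=`
    [set b : seq (I * bool) | [set` b] `<=` [set ic : I * bool | ic.1 \in s]]]).
  apply: countable_image; apply: countable_seq; apply: countable_seq.
  rewrite (_ : mkset _ = [set` s] `*` [set: bool]).
    apply: countableX; last exact: countableP.
    exact: finite_set_countable (finite_seq s).
  by apply/seteqP; split=> [ic /= ?|ic []].
move=> bs bss; exists bs => // b bbs ic icb; exact: bss bbs icb.
Qed.

(** If [U] has a point other than [x], some neighbourhood of [x] in [A] misses that point; otherwise
    [U] is the singleton of [x] and serves itself. By compactness finitely many such sets
    suffice. *)
Let ruled_split : ruled (fun M : set T => forall U x, A U -> M (inl U) -> U !=set0 ->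
    exists C, [/\ A C, M (inl C), C x & ~ (U `<=` C) \/ exists p, C = [set p]]).
Proof.
apply: ruledW (ruled_family (enc := enc1) (Q := fun U D => A U -> U !=set0 ->
  forall x, exists C, [/\ A C, D (inl C), C x & ~ (U `<=` C) \/ exists p, C = [set p]])
  enc1_inj _).
  move=> M H U x AU MU U0; have [D DM] := H U (enc1P MU).
  by move=> /(_ AU U0 x)[C [AC /DM MC Cx CU]]; exists C.
move=> U; have [[AU [p Up]]|N] := pselect (A U /\ U !=set0); last first.
  by exists set0 => // AU U0; case: N.
have [|||s sP sX] := @compact_finite_cover X setT
    [set C | A C /\ (~ (U `<=` C) \/ exists p, C = [set p])].
- by [].
- by move=> C [/Aopen].
- move=> x _.
  have avoid q : U q -> q <> x -> exists2 C, A C & C x /\ ~ (U `<=` C).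
    move=> Uq qx; have [||C AC [Cx Cq]] := Abase.2 (~` [set q]) _ x.
    + exact/closed_openC/accessible_closed_set1/hausdorff_accessible.
    + by move=> xq; apply: qx.
    by exists C => //; split=> // /(_ q Uq)/Cq; exact.
  have [[q [Uq qx]]|N] := pselect (exists q, U q /\ q <> x).
    by have [C AC [Cx CU]] := avoid q Uq qx; exists C => //; split=> //; left.
  have Ux q : U q -> q = x by move=> Uq; apply: contrapT => qx; apply: N; exists q.
  exists U; last by rewrite -(Ux p Up).
  split=> //; right; exists x; apply/seteqP; split=> [q /Ux //|_ ->].
  by rewrite -(Ux p Up).
exists (inl @` [set` s]); first exact/countable_image/finite_set_countable/finite_seq.
move=> _ _ x; have [//|C Cs Cx] := sX x; have [AC CU] := sP _ Cs.
by exists C; split=> //; exists C.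
Qed.

Lemma ruled_reflecting : ruled reflecting.
Proof.
have := ruledI ruled_up (ruledI ruled_interpolate (ruledI ruled_meet
  (ruledI ruled_chain (ruledI ruled_support (ruledI ruled_boxes ruled_split))))).
by apply: ruledW => M [? [? [? [? [? [? ?]]]]]]; exact: Reflecting.
Qed.

(* Projecting finitely many boxes inside [f @^-1` V] to the coordinates in [N]
   does not leave [f @^-1` W] when [W] is in [N], for such a [W] only depends
   on these coordinates. *)
Lemma reflecting_trace (N : set T) (V : set X) : reflecting N ->
  open V -> V !=set0 -> exists V', [/\ A V', N (inl V'), V' !=set0 &
    forall W, A W -> N (inl W) -> V `<=` W -> V' `<=` W].
Proof.
move=> Nr Vo [x Vx].
have [V0 [AV0 V0x V0V]] := base_closure Xc XT2 Abase Vo Vx.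
have [|||bs bsV bsV0] := @cube_compact_box_cover I (f @^-1` closure V0) (f @^-1` V).
- apply: subclosed_compact (@cantor_cube_compact I) _ => //.
  by apply: preimage_closed; [move=> y _; exact: fc|exact: closed_closure].
- by apply: open_comp => // y _; exact: fc.
- by move=> y /V0V.
pose restr (b : seq (I * bool)) := [seq ic <- b | `[< N (inr ic.1) >]].
have [||||V' [AV' NV' V'0 V'bs]] := @refl_boxes _ Nr (map restr bs) V0.
- by move=> _ ic /mapP[b _ ->]; rewrite mem_filter => /andP[/asboolP].
- exact: Aopen.
- by exists x.
- move=> u V0u; have [|y _ yu] := fsurj (t := u); first by [].
  subst u.
  have [b bbs yb] := bsV0 y (subset_closure V0u).
  exists y => //; exists (restr b); first exact: map_f.
  by move=> ic; rewrite mem_filter => /andP[_]; exact: yb.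
exists V'; split=> // W AW NW VW _ /V'bs[y [_ /mapP[b bbs ->] yb] <-].
have [[z zb] bV] := bsV b bbs.
(* [y'] lies in the full box [b], so [f y'] is in [V] and hence in [W]; as [y'] agrees with [y] on
   the coordinates in [N], [f y] is in [W] too. *)
pose y' : cantor_cube I := fun i => if `[< N (inr i) >] then y i else z i.
apply: (refl_support Nr AW NW (y := y')).
  by move=> i Ni; rewrite /y'; case: asboolP.
apply/VW/bV => ic icb; rewrite /y'; case: asboolP => Ni; last exact: zb.
by apply: yb; rewrite mem_filter icb andbT; apply/asboolP.
Qed.

(** * Thinning inside one countable closed set *)

(** The members of [vs] are treated one after another by [refl_split], shrinking with [refl_meet];
    both alternatives survive passing to a smaller neighbourhood of [x]. *)
Lemma reflecting_refine (M : set T) (vs : seq (set X)) U x : reflecting M ->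
  (forall V, V \in vs -> [/\ A V, M (inl V) & V !=set0]) ->
  A U -> M (inl U) -> U x -> exists W, [/\ A W, M (inl W), W x, W `<=` U &
    forall V, V \in vs -> ~ (V `<=` W) \/ exists p, W = [set p]].
Proof.
move=> Mr vsP AU MU Ux; elim: vs vsP => [|V vs IH] vsP.
  by exists U; split=> // V.
have [|W [AW MW Wx WU Wvs]] := IH.
  by move=> V' V'vs; apply: vsP; rewrite inE V'vs orbT.
have [|AV MV V0] := vsP V; first exact: mem_head.
have [C [AC MC Cx CV]] := refl_split Mr x AV MV V0.
have [W' [AW' MW' W'x W'WC]] := refl_meet Mr AW MW AC MC Wx Cx.
have {}W'WC : W' `<=` W `&` C by apply: subset_trans W'WC; exact: subset_closure.
have sub1 D : W' `<=` D -> (exists p, D = [set p]) -> exists p, W' = [set p].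
  move=> W'D [p Dp]; exists x; apply/seteqP; split=> [y W'y|_ ->//].
  by move: (W'D _ W'y) (W'D _ W'x); rewrite Dp => -> ->.
exists W'; split=> //; first by move=> y /W'WC[/WU].
move=> V'.
have W'W : W' `<=` W by move=> y /W'WC[].
have W'C : W' `<=` C by move=> y /W'WC[].
rewrite inE => /orP[/eqP ->|/Wvs[NW|/(sub1 _ W'W)]]; [|left|by right].
  case: CV => [NC|/(sub1 _ W'C)]; [left|by right].
  by move=> VW'; apply: NC; exact: subset_trans W'C.
by move=> VW'; apply: NW; exact: subset_trans W'W.
Qed.

(* A compact piece [K m] of the [n]-th member of [S] is covered by members of
   [S] that are singletons or contain none of the first [n + m] nonempty sets of
   [A] in [M]. *)
Lemma reflecting_thin (M : set T) (S : set_system X) :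
  reflecting M -> countable M ->
  (forall U, S U -> A U /\ M (inl U)) ->
  (forall U V, S U -> A V -> M (inl V) -> V !=set0 -> V `<=` U -> S V) ->
  exists2 S' : set_system X, S' `<=` S &
    (forall U x, S U -> U x -> exists2 V, S' V & V x /\ V `<=` U) /\
    (forall V, A V -> M (inl V) -> V !=set0 -> finite_set [set W | S' W /\ V `<=` W]).
Proof.
move=> Mr Mc SM Sdown.
have [e einj] : exists e : set X -> nat, forall U V, M (inl U) -> M (inl V) ->
    e U = e V -> U = V.
  have /countable_injP[e einj] := Mc.
  exists (fun U => e (inl U)) => U V MU MV eUV.
  by have [] : inl U = inl V :> T by apply: einj; rewrite ?inE.
have efin n : finite_set [set U | M (inl U) /\ (e U < n)%N].
  rewrite (_ : mkset _ = \bigcup_(k in `I_n) [set U | M (inl U) /\ e U = k]).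
    apply: bigcup_finite => // k _.
    have [[U [MU eU]]|N] := pselect (exists U, M (inl U) /\ e U = k); last first.
      by apply: sub_finite_set (finite_set0 _) => V VP; apply: N; exists V.
    apply: sub_finite_set (finite_set1 U) => V [MV eV].
    by apply: einj => //; rewrite eU eV.
  by apply/seteqP; split=> [U [MU eU]|U [k kn [MU eU]]] /=; [exists (e U)|rewrite eU].
have [K KP] : {K : set X -> nat -> set X & forall U, S U ->
    (forall n, compact (K U n)) /\ U = \bigcup_n K U n}.
  apply: (@choice _ _ (fun U K => S U -> (forall n, compact (K n)) /\
    U = \bigcup_n K n)) => U.
  have [SU|N] := pselect (S U); last by exists (fun=> set0).
  have [K KP] := cozero_sigma_compact Xc (Acozero (SM _ SU).1).
  by exists K.
have [c cP] : {c : set X * nat -> seq (set X) & forall Um, S Um.1 ->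
    (forall W, W \in c Um -> [/\ S W, W `<=` Um.1 & (exists p, W = [set p]) \/
       forall V, A V -> M (inl V) -> V !=set0 ->
         (e V <= e Um.1 + Um.2)%N -> ~ V `<=` W]) /\
    (forall x, K Um.1 Um.2 x -> exists2 W, W \in c Um & W x)}.
  apply: (@choice _ _ (fun Um c => S Um.1 ->
    (forall W, W \in c -> [/\ S W, W `<=` Um.1 & (exists p, W = [set p]) \/
       forall V, A V -> M (inl V) -> V !=set0 ->
         (e V <= e Um.1 + Um.2)%N -> ~ V `<=` W]) /\
    (forall x, K Um.1 Um.2 x -> exists2 W, W \in c & W x))) => -[U m] /=.
  have [SU|N] := pselect (S U); last by exists [::].
  have [Kc UK] := KP U SU; have [AU MU] := SM U SU.
  have [|||s sP sK] := @compact_finite_cover X (K U m) [set W | [/\ S W, W `<=` U &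
    (exists p, W = [set p]) \/ forall V, A V -> M (inl V) -> V !=set0 ->
      (e V <= e U + m)%N -> ~ V `<=` W]].
  - exact: Kc.
  - by move=> W [/SM[/Aopen]].
  - move=> x Kx; have Ux : U x by rewrite UK; exists m.
    have /finite_seqP[vs vsE] : finite_set [set V | [/\ A V, M (inl V), V !=set0 &
        (e V <= e U + m)%N]].
      by apply: sub_finite_set (efin (e U + m).+1) => V [].
    have [|W [AW MW Wx WU Wvs]] := @reflecting_refine M vs U x Mr _ AU MU Ux.
      move=> V Vvs; have : [set` vs] V by [].
      by rewrite -vsE => -[].
    exists W => //; split=> //; first by apply: (Sdown U) => //; exists x.
    have [|N] := pselect (exists p, W = [set p]); [by left|right].
    move=> V AV MV V0 eV; have : [set` vs] V by rewrite -vsE.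
    by move=> /Wvs[].
  by exists s.
exists (\bigcup_(Um in [set Um | S Um.1]) [set` c Um]).
  by move=> W [Um SU /= Wc]; have [/(_ W Wc)[]] := cP Um SU.
split=> [U x SU Ux|V AV MV V0].
  have [_ UK] := KP U SU; move: (Ux); rewrite {1}UK => -[m _ Kx].
  have [cU /(_ x Kx)[W Wc Wx]] := cP (U, m) SU.
  by have [SW WU _] := cU W Wc; exists W => //; exists (U, m).
(* Let [W] come from [c (U, m)]. If $e(V)\le e(U)+m$, then [W] is a singleton and equals [V];
   otherwise both $e(U)$ and $m$ are below $e(V)$, which leaves finitely many finite lists. *)
apply: (@sub_finite_set _ _ ([set V] `|`
    \bigcup_(Um in [set U | M (inl U) /\ (e U < e V)%N] `*` `I_(e V)) [set` c Um])).
  move=> W [[Um SU /= Wc] VW]; have [/(_ W Wc)[SW WU Wp] _] := cP Um SU.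
  have [le|gt] := leqP (e V) (e Um.1 + Um.2); [left|right].
    case: Wp => [[p Wp]|/(_ V AV MV V0 le)//].
    apply/seteqP; split=> // y; case: V0 => v Vv.
    by have := VW v Vv; rewrite Wp => vp yp; rewrite yp -vp.
  exists Um => //; split; last exact: leq_ltn_trans (leq_addl _ _) gt.
  split; first by have [] := SM _ SU.
  exact: leq_ltn_trans (leq_addr _ _) gt.
rewrite finite_setU; split; first exact: finite_set1.
by apply: bigcup_finite => [|Um _]; [apply: finite_setX => //|exact: finite_seq].
Qed.

(** * The base assembled along the tree *)

Theorem omega_op_like_subbase :
  exists2 S : set_system X, S `<=` A & is_base S /\ omega_op_like S.
Proof.
have [R Rc Rr] := ruled_reflecting.
have [L [lt [M [lt_wf lt_tot McP McovP Mfin]]]] := davies_tree Rc.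
have Mr s : reflecting (M s) by apply: Rr; have [] := McP s.
pose new s W := M s (inl W) /\ forall t, lt t s -> ~ M t (inl W).
pose S s := [set U | [/\ A U, M s (inl U), U !=set0 &
  exists W, [/\ B W, new s W & U `<=` W]]].
have [S' S'P] : {S' : L -> set_system X & forall s, [/\ S' s `<=` S s,
    forall U x, S s U -> U x -> exists2 V, S' s V & V x /\ V `<=` U &
    forall V, A V -> M s (inl V) -> V !=set0 ->
      finite_set [set W | S' s W /\ V `<=` W]]}.
  apply: (@choice _ _ (fun s S' => [/\ S' `<=` S s,
    forall U x, S s U -> U x -> exists2 V, S' V & V x /\ V `<=` U &
    forall V, A V -> M s (inl V) -> V !=set0 ->
      finite_set [set W | S' W /\ V `<=` W]])) => s.
  have [||S' S'S [S'b S'f]] := @reflecting_thin (M s) (S s) (Mr s) (McP s).2.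
  - by move=> U [].
  - move=> U V [_ _ _ [W [BW nW UW]]] AV MV V0 VU; split=> //.
    by exists W; split=> //; exact: subset_trans UW.
  by exists S'.
have S'A s U : S' s U -> S s U by have [+ _ _] := S'P s; exact.
have fin s V : A V -> M s (inl V) -> V !=set0 ->
    finite_set [set W | (exists t, S' t W) /\ V `<=` W].
  elim/(well_founded_ind lt_wf): s V => s IH V AV MV V0.
  have [n [N [Nc NE]]] := Mfin s.
  have [V' V'P] : {V' : nat -> set X & forall j, [/\ A (V' j), N j (inl (V' j)),
      V' j !=set0 & forall W, A W -> N j (inl W) -> V `<=` W -> V' j `<=` W]}.
    apply: (@choice _ _ (fun j V' => [/\ A V', N j (inl V'),
      V' !=set0 & forall W, A W -> N j (inl W) -> V `<=` W -> V' `<=` W])) => j.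
    exact: reflecting_trace (Rr _ (Nc j)) (Aopen AV) V0.
  apply: (@sub_finite_set _ _ ([set W | S' s W /\ V `<=` W] `|`
      \bigcup_(j in `I_n) [set W | (exists t, S' t W) /\ V' j `<=` W])).
    move=> W [[t S'W] VW]; have [AW MW W0 [W' [BW' [MW' W'new] WW']]] := S'A _ _ S'W.
    have [lts|ts|lts] := lt_tot t s; last 2 first.
    - by left; rewrite -ts.
    (* If [s] precedes [t], then [W'] contains [V] and so a member of [B] in [M s]; upward closure
       puts [W'] into [M s], although it is new at [t]. *)
    - case: V0 => x Vx.
      have [_ [_ [V1 [_ [_ [BV1 MV1 _ V1V]]]]]] := refl_chain (Mr s) AV MV Vx.
      case: (W'new s lts); apply: (refl_up (Mr s) BV1 MV1 BW').
      by apply: subset_trans WW'; apply: subset_trans VW.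
    have [j jn NW] : exists2 j, (j < n)%N & N j (inl W) by apply/NE; exists t.
    right; exists j => //; split; first by exists t.
    by have [_ _ _ V'W] := V'P j; exact: V'W.
  rewrite finite_setU; split; first by have [_ _] := S'P s; exact.
  apply: bigcup_finite => // j jn; have [AV' NV' V'0 _] := V'P j.
  (* The trace [V' j] already belongs to an earlier [M t], so the induction hypothesis bounds its
     chosen supersets. *)
  have [t lts MV'] : exists2 t, lt t s & M t (inl (V' j)) by apply/NE; exists j.
  exact: IH MV' V'0.
exists [set U | exists s, S' s U]; first by move=> U [s /S'A[]].
split; last first.
  by move=> U [s S'U]; have [AU MU U0 _] := S'A _ _ S'U; exact: fin MU U0.
split=> [U [s /S'A[/Aopen]] //|V Vo x Vx].
have [s [[U [AU MU Ux UV]] smin]] : exists s,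
    (exists U, [/\ A U, M s (inl U), U x & U `<=` V]) /\
    forall t, lt t s -> ~ exists U, [/\ A U, M t (inl U), U x & U `<=` V].
  apply: contrapT => N; have [U AU [Ux UV]] := Abase.2 _ Vo _ Vx.
  have [s MU] := McovP (inl U).
  suff : ~ exists U, [/\ A U, M s (inl U), U x & U `<=` V] by apply; exists U.
  elim/(well_founded_ind lt_wf): s {MU} => s IH H.
  by apply: N; exists s; split.
have [U' [W' [W [[AU' MU' U'x] [[BW' MW' U'W'] [BW MW W'W WU]]]]]] :=
  refl_chain (Mr s) AU MU Ux.
have SU' : S s U'.
  split=> //; first by exists x.
  exists W'; split=> //; split=> // t lts MtW'; apply: (smin t lts).
  have MtW : M t (inl W).
    apply: (refl_up (Mr t) BW' MtW' BW).
    by apply: subset_trans W'W; exact: subset_closure.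
  have [U1 [AU1 MU1 U1x U1W]] :=
    refl_interpolate (Mr t) BW' MtW' BW MtW W'W (U'W' _ U'x).
  by exists U1; split=> //; apply: subset_trans UV; exact: subset_trans WU.
have [_ /(_ U' x SU' U'x)[U1 S'U1 [U1x U1U']] _] := S'P s.
exists U1; first by exists s.
split=> //; apply: subset_trans UV; apply: subset_trans WU.
apply: subset_trans W'W; apply: subset_trans (@subset_closure _ _).
exact: subset_trans U'W'.
Qed.

End Reflection.

Theorem theorem3p36 :
  (forall (X : topologicalType) (A : set_system X),
      dyadic_compactum X ->
      is_base A -> (forall U, A U -> cozero_set U) ->
      Nt_le_omega1 X ->
      exists2 B : set_system X, B `<=` A & is_base B /\ omega_op_like B) /\
  (forall X : topologicalType, dyadic_compactum X -> ~ Nt_eq_omega1 X).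
Proof.
have subbase (X : topologicalType) (A : set_system X) : dyadic_compactum X ->
    is_base A -> (forall U, A U -> cozero_set U) -> Nt_le_omega1 X ->
    exists2 B : set_system X, B `<=` A & is_base B /\ omega_op_like B.
  (* The arbitrary index type receives a choice structure, as the rules act on a [choiceType]. *)
  move=> [Xc [XT2 [I]]]; elim/Pchoice: I => I [f [fc fsurj]] Ab Az [B [Bb Bop]].
  exact: (omega_op_like_subbase Xc XT2 fc fsurj Ab Az Bb Bop).
split=> // X dX [Nt1]; apply.
have [Xc [XT2 _]] := dX.
(* The family of all cozero sets takes the role of [A]. *)
have [B _ BP] := subbase X _ dX (cozero_base Xc XT2) (fun _ => id) Nt1.
by exists B.
Qed.
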